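(* Let $M^n_{\mathrm{reg}}\subset\mathbb{R}^{n+k}$ be a regular $n$-manifold, let $u$ be a tangent direction (unit tangent vector) of $M^n_{\mathrm{reg}}$ at a point $p'$, and let $M^n_{\mathrm{sing}}\subset\mathbb{R}^{n+k-1}$ be the projection of $M^n_{\mathrm{reg}}$ along $u$. Then the direction of projection $u$ becomes the null tangent direction of the singular projection; that is, if $I^P$ denotes the first fundamental form of the singular projection at $p'$, then $I^P(u,u)=0$.
   Context: Let $f(x_1,\dots,x_n)$ be a local parametrisation of $M^n_{\mathrm{reg}}$ near $p'$. The projection along the unit vector $u\in T_{p'}M^n_{\mathrm{reg}}$ is $P_u=f-\langle f,u\rangle u$, with values in $u^\perp\cong\mathbb{R}^{n+k-1}$; its image is $M^n_{\mathrm{sing}}$, which is singular of corank $1$ at the image of $p'$. $M^n_{\mathrm{sing}}$ is regarded as the image of $g:\tilde M\to\mathbb{R}^{n+k-1}$ with $\tilde M=M^n_{\mathrm{reg}}$ and $g$ the restricted projection, $q=p'$, so $T_q\tilde M=T_{p'}M^n_{\mathrm{reg}}$. The first fundamental form of the singular projection is the pseudo-metric $I^P(a,b)=\langle dg_q(a),dg_q(b)\rangle$ on $T_q\tilde M$. The null tangent direction is the direction $u\in T_q\tilde M$, $u\ne0$, with $I^P(u,u)=0$ (equivalently, spanning $\ker dg_q$). Here $n,k\ge1$. *)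

(* Defs.v *)
From HB Require Import structures.
From mathcomp Require Import all_boot all_order all_algebra.
From mathcomp Require Import all_classical all_reals all_analysis.

Set Implicit Arguments.
Unset Strict Implicit.
Unset Printing Implicit Defensive.

Import Order.TTheory GRing.Theory Num.Theory.
Import numFieldNormedType.Exports.

Local Open Scope classical_set_scope.
Local Open Scope ring_scope.

(* Points and vectors of R^m are row vectors. The library norm on 'rV[R]_m is
   the sup norm (used for the topology only); lengths and angles are taken with
   respect to the Euclidean inner product below. *)
Definition dot (R : realType) (m : nat) (a b : 'rV[R]_m) : R :=
  \sum_(i < m) a 0 i * b 0 i.

(* C^oo on the open set U: every iterated directional derivative of f, of any
   order (including f itself), is Frechet differentiable at every point of U. *)
Definition smooth_on (R : realType) (n m : nat) (U : set 'rV[R]_n)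
    (f : 'rV[R]_n -> 'rV[R]_m) : Prop :=
  forall (vs : seq 'rV[R]_n) (x : 'rV[R]_n), U x ->
    differentiable (foldr (fun v h => 'D_v h) f vs) x.

(* f, restricted to the open set U of R^n, is a local parametrisation of M: a
   smooth immersion which is a homeomorphism from U onto a relatively open
   subset of M. Only the values of f on U are relevant. *)
Definition local_parametrisation (R : realType) (n m : nat) (M : set 'rV[R]_m)
    (U : set 'rV[R]_n) (f : 'rV[R]_n -> 'rV[R]_m) : Prop :=
  [/\ open U,
      smooth_on U f,
      (forall x, U x -> \rank ('J f x) = n),
      {in U &, injective f} &
      forall W, open W -> W `<=` U ->
        exists2 V : set 'rV[R]_m, open V & f @` W = M `&` V].

Definition regular_manifold (R : realType) (n m : nat) (M : set 'rV[R]_m) :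
    Prop :=
  forall p, M p -> exists (U : set 'rV[R]_n) (f : 'rV[R]_n -> 'rV[R]_m)
    (x : 'rV[R]_n), [/\ local_parametrisation M U f, U x & f x = p].

(* The tangent vector v of M at p is represented by the vector w at the point x
   of the domain of the local parametrisation f. *)
Definition represents (R : realType) (n m : nat) (M : set 'rV[R]_m)
    (p v : 'rV[R]_m) (U : set 'rV[R]_n) (f : 'rV[R]_n -> 'rV[R]_m)
    (x w : 'rV[R]_n) : Prop :=
  [/\ local_parametrisation M U f, U x, f x = p & 'd f x w = v].

Definition tangent_space (R : realType) (n m : nat) (M : set 'rV[R]_m)
    (p : 'rV[R]_m) : set 'rV[R]_m :=
  [set v | exists U f x w, @represents R n m M p v U f x w].

(* The differential at p of (the restriction to M of) g, computed in a local
   parametrisation: df_x(w) |-> d(g o f)_x(w). When g is smooth on M the result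
   does not depend on the parametrisation; xget selects that value (and returns
   0 on vectors which are not tangent to M at p). *)
Definition manifold_diff (R : realType) (n m l : nat) (M : set 'rV[R]_m)
    (g : 'rV[R]_m -> 'rV[R]_l) (p v : 'rV[R]_m) : 'rV[R]_l :=
  xget 0 [set z | exists U f x w,
    @represents R n m M p v U f x w /\ 'd (g \o f) x w = z].

Definition first_fundamental_form (R : realType) (n m l : nat)
    (M : set 'rV[R]_m) (g : 'rV[R]_m -> 'rV[R]_l) (p a b : 'rV[R]_m) : R :=
  dot (manifold_diff n M g p a) (manifold_diff n M g p b).

(* u is the null direction of the pseudo-metric I on the tangent space T: it is
   a nonzero vector of T, and the null vectors of T are exactly the multiples
   of u. *)
Definition null_tangent_direction (R : realType) (m : nat)
    (T : set 'rV[R]_m) (I : 'rV[R]_m -> 'rV[R]_m -> R) (u : 'rV[R]_m) : Prop :=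
  [/\ T u, u != 0 &
      forall v, T v -> (I v v = 0 <-> exists c : R, v = c *: u)].

(* The restriction of iota to the hyperplane orthogonal to u is a linear
   isometry onto R^(m-1), i.e. an identification of the two Euclidean spaces.
   The values of iota off the hyperplane are irrelevant. *)
Definition hyperplane_identification (R : realType) (m : nat) (u : 'rV[R]_m)
    (iota : {linear 'rV[R]_m -> 'rV[R]_m.-1}) : Prop :=
  (forall a b, dot a u = 0 -> dot b u = 0 -> dot (iota a) (iota b) = dot a b) /\
  (forall z, exists2 a, dot a u = 0 & iota a = z).

Definition projection_along (R : realType) (m : nat) (u : 'rV[R]_m)
    (iota : {linear 'rV[R]_m -> 'rV[R]_m.-1}) (y : 'rV[R]_m) : 'rV[R]_m.-1 :=
  iota (y - dot y u *: u).

(* Main.v *)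
Require Import Defs.
From HB Require Import structures.
From mathcomp Require Import all_boot all_order all_algebra.
From mathcomp Require Import all_classical all_reals all_analysis.

Set Implicit Arguments.
Unset Strict Implicit.
Unset Printing Implicit Defensive.

Import Order.TTheory GRing.Theory Num.Theory.
Import numFieldNormedType.Exports.

Local Open Scope classical_set_scope.
Local Open Scope ring_scope.

(** Every local parametrisation f of Mreg satisfies g \o f = P \o f near the
    base point, P being the linear projection along u; by the chain rule the
    differential of g at p is therefore P on the tangent space, so that
    I^P(v, v) = |v - <v, u> u|^2. This vanishes exactly when v is a multiple
    of u. *)

Lemma dotDl (R : realType) (m : nat) (a b c : 'rV[R]_m) :
  dot (a + b) c = dot a c + dot b c.
Proof. by rewrite /dot -big_split; apply: eq_bigr => i _; rewrite mxE mulrDl. Qed.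

Lemma dotZl (R : realType) (m : nat) (k : R) (a c : 'rV[R]_m) :
  dot (k *: a) c = k * dot a c.
Proof. by rewrite /dot mulr_sumr; apply: eq_bigr => i _; rewrite mxE mulrA. Qed.

Lemma dot_eq0 (R : realType) (m : nat) (a : 'rV[R]_m) :
  (dot a a == 0) = (a == 0).
Proof.
apply/idP/idP => [|/eqP ->]; last first.
  by rewrite /dot big1 // => i _; rewrite mxE mul0r.
rewrite psumr_eq0 => [/allP a0|i _]; last by rewrite -expr2 sqr_ge0.
apply/eqP/rowP => i; rewrite mxE.
by have := a0 i (mem_index_enum i); rewrite mulf_eq0 orbb => /eqP.
Qed.

(** Expanding in the standard basis turns [h] into a finite sum of coordinate functions times fixed
    vectors, each of them continuous. *)
Lemma linear_rV_continuous (R : realType) (m : nat) (W : normedModType R)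
    (h : {linear 'rV[R]_m -> W}) : continuous h.
Proof.
have -> : h = (fun y => \sum_(i < m) y 0 i *: h (delta_mx 0 i)) :> (_ -> _).
  apply/funext => y; rewrite {1}[y]row_sum_delta linear_sum.
  by apply: eq_bigr => i _; rewrite linearZ.
apply: continuous_big => [|i _ y]; first exact: add_continuous.
by apply: (@cvgZr_tmp _ _ _ (nbhs y)); exact: coord_continuous.
Qed.

(** The differential depends only on the germ: the first-order expansion of [f] at [x] also serves
    [h], and such an expansion is unique. This matters because [g] is prescribed on the manifold
    only. *)
Lemma diff_near_eq (R : realType) (V W : normedModType R) (f h : V -> W)
    (x : V) : differentiable f x -> (\forall y \near x, h y = f y) ->
  'd h x = 'd f x :> (V -> W).
Proof.
move=> df hf; apply: diff_unique; first exact: diff_continuous.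
have hx : h x = f x by exact: nbhs_singleton hf.
rewrite hx; apply/eqaddoP => e e0.
move: hf; rewrite [in X in X -> _](near_shift 0) subr0 => hf.
have /eqaddoP/(_ e e0) := diff_locally df.
apply: filterS2 hf => y /= hy.
by rewrite !fctE /= hy.
Qed.

Lemma projection_along_is_linear (R : realType) (m : nat) (u : 'rV[R]_m)
    (iota : {linear 'rV[R]_m -> 'rV[R]_m.-1}) :
  linear (projection_along u iota).
Proof.
move=> k a b; rewrite /projection_along -linearP dotDl dotZl.
by rewrite scalerBr scalerDl scalerA opprD addrACA.
Qed.

HB.instance Definition _ (R : realType) (m : nat) (u : 'rV[R]_m)
    (iota : {linear 'rV[R]_m -> 'rV[R]_m.-1}) :=
  GRing.isLinear.Build R 'rV[R]_m 'rV[R]_m.-1 *:%R (projection_along u iota)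
    (projection_along_is_linear u iota).

Lemma local_parametrisation_mem (R : realType) (n m : nat) (M : set 'rV[R]_m)
    (U : set 'rV[R]_n) (f : 'rV[R]_n -> 'rV[R]_m) (x : 'rV[R]_n) :
  local_parametrisation M U f -> U x -> M (f x).
Proof.
(* The homeomorphism clause is applied to [U] itself. *)
move=> [oU _ _ _ /(_ U oU (@subset_refl _ U))[V _ fU]] Ux.
have : (f @` U) (f x) by exists x.
by rewrite fU => -[].
Qed.

Lemma manifold_diff_linear (R : realType) (n m l : nat) (M : set 'rV[R]_m)
    (g : 'rV[R]_m -> 'rV[R]_l) (h : {linear 'rV[R]_m -> 'rV[R]_l})
    (p v : 'rV[R]_m) :
  (forall y, M y -> g y = h y) -> tangent_space n M p v ->
  manifold_diff n M g p v = h v.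
Proof.
move=> gh.
(* Every representation of [v] yields the same value, so the choice made by [xget] is harmless. *)
have dgf U f x w : @represents R n m M p v U f x w -> 'd (g \o f) x w = h v.
  move=> [fP Ux fx dfw]; have [oU sf _ _ _] := fP.
  have df : differentiable f x by exact: (sf [::]).
  have dh y : differentiable h y.
    by apply: linear_differentiable; exact: linear_rV_continuous.
  rewrite (@diff_near_eq _ _ _ (h \o f)); first last.
  - have := open_nbhs_nbhs (conj oU Ux); apply: filterS => y Uy /=.
    exact/gh/(local_parametrisation_mem fP).
  - exact: differentiable_comp.
  rewrite diff_comp //= dfw diff_lin //; exact: linear_rV_continuous.
move=> [U [f [x [w fw]]]]; rewrite /manifold_diff.
(* The default value 0 is excluded: [v] is tangent, so some representation exists. *)
case: xgetP => [z _ [U' [f' [x' [w' [/dgf <- ->]]]]] //|/(_ (h v)) []].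
exists U, f, x, w; split; [exact: fw|exact: dgf fw].
Qed.

Lemma dot_projection_along_eq0 (R : realType) (m : nat) (u v : 'rV[R]_m)
    (iota : {linear 'rV[R]_m -> 'rV[R]_m.-1}) :
  dot u u = 1 -> hyperplane_identification u iota ->
  dot (projection_along u iota v) (projection_along u iota v) = 0 <->
  exists c : R, v = c *: u.
Proof.
move=> uu [iotaE _].
(* [iota] preserves inner products only on the hyperplane orthogonal to [u], so the rejected vector
   must first be placed there. *)
have vu : dot (v - dot v u *: u) u = 0.
  by rewrite -scaleNr dotDl dotZl uu mulr1 subrr.
rewrite /projection_along iotaE //; split=> [/eqP|[c ->]].
  by rewrite dot_eq0 subr_eq0 => /eqP vE; exists (dot v u).
by apply/eqP; rewrite dotZl uu mulr1 subrr dot_eq0.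
Qed.

Theorem proposition5p5 (R : realType) (n k : nat)
    (n_gt0 : (0 < n)%N) (k_gt0 : (0 < k)%N)
    (Mreg : set 'rV[R]_(n + k)) (Mreg_regular : regular_manifold n Mreg)
    (p u : 'rV[R]_(n + k)) (Mp : Mreg p)
    (u_tangent : tangent_space n Mreg p u) (u_unit : dot u u = 1)
    (iota : {linear 'rV[R]_(n + k) -> 'rV[R]_(n + k).-1})
    (iota_isometry : hyperplane_identification u iota)
    (g : 'rV[R]_(n + k) -> 'rV[R]_(n + k).-1)
    (gE : forall y, Mreg y -> g y = projection_along u iota y)
    (Msing : set 'rV[R]_(n + k).-1) (MsingE : Msing = g @` Mreg) :
  let IP := first_fundamental_form n Mreg g p in
  null_tangent_direction (tangent_space n Mreg p) IP u /\ IP u u = 0.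
Proof.
have IPE v : tangent_space n Mreg p v ->
    first_fundamental_form n Mreg g p v v = 0 <-> exists c : R, v = c *: u.
  move=> Tv; rewrite /first_fundamental_form.
  rewrite (@manifold_diff_linear _ _ _ _ _ g (projection_along u iota)) //.
  exact: dot_projection_along_eq0.
split; last by apply/IPE => //; exists 1; rewrite scale1r.
(* A unit vector is nonzero, since its square length is 1. *)
by split=> //; rewrite -dot_eq0 u_unit oner_neq0.
Qed.
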